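(* Consider either the simply supported case or the Cahn--Hilliard case, with the corresponding spaces and forms defined in the context. Let $T>0$, $J:=(0,T]$, $\gamma>0$, $g(u):=u^3-u$, let $f\in L^2(J;L^2(\Omega))$, $\ell(v):=(f(t),v)_{0,\Omega}$, and let $u_0$ be the initial datum. Let $((u(t),\boldsymbol{\sigma}(t)),\boldsymbol{\phi}(t))\in\mathbb{V}\times\mathbf{M}$, $t\in J$, be the solution, with $u(\cdot,0)=u_0$, of the weak form of the extended Fisher--Kolmogorov equation: for every $t\in J$, $$(\partial_t u,v)_{0,\Omega}+\gamma\big(a((u,\boldsymbol{\sigma}),(v,\boldsymbol{\tau}))+b((v,\boldsymbol{\tau}),\boldsymbol{\phi})\big)+c(\boldsymbol{\sigma},\boldsymbol{\tau})+(g(u),v)_{0,\Omega}=\ell(v)\quad\forall (v,\boldsymbol{\tau})\in\mathbb{V},$$ $$b((u,\boldsymbol{\sigma}),\boldsymbol{\psi})=0\quad\forall\boldsymbol{\psi}\in\mathbf{M}.$$ Then the following stability estimate holds: $$\tfrac12\|u\|_{L^\infty(\overline{J};L^2(\Omega))}^2+\gamma\|\mathrm{div}\,\boldsymbol{\sigma}\|_{L^2(J;L^2(\Omega))}^2+\|\boldsymbol{\sigma}\|_{L^2(J;L^2(\Omega))}^2\ \lesssim\ \|u_0\|_{0,\Omega}^2+\|f\|_{L^2(J;L^2(\Omega))}^2.$$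
   Context: $\Omega\subset\mathbb{R}^d$, $d\in\{2,3\}$, is a bounded convex domain with polygonal or polyhedral boundary $\Gamma=\partial\Omega$ and outward unit normal $\boldsymbol{n}$. $(\cdot,\cdot)_{0,\Omega}$ and $\|\cdot\|_{0,\Omega}$ are the $L^2(\Omega)$ inner product and norm (for scalar or vector fields). Let $H_0(\mathrm{div},\Omega):=\{\boldsymbol{\tau}\in H(\mathrm{div},\Omega):\boldsymbol{\tau}\cdot\boldsymbol{n}=0\text{ on }\Gamma\}$. Spaces: in the simply supported case, $U:=L^2(\Omega)$ and $\mathbf{M}:=H(\mathrm{div},\Omega)$; in the Cahn--Hilliard case, $U:=\{v\in L^2(\Omega):\int_\Omega v\,dx=0\}$ and $\mathbf{M}:=H_0(\mathrm{div},\Omega)$. In both cases $\mathbb{V}:=U\times\mathbf{M}$. Bilinear forms: $a((u,\boldsymbol{\sigma}),(v,\boldsymbol{\tau})):=\int_\Omega \mathrm{div}\,\boldsymbol{\sigma}\;\mathrm{div}\,\boldsymbol{\tau}\,dx$, $b((v,\boldsymbol{\tau}),\boldsymbol{\psi}):=\int_\Omega(\boldsymbol{\tau}\cdot\boldsymbol{\psi}+v\,\mathrm{div}\,\boldsymbol{\psi})\,dx$, $c(\boldsymbol{\sigma},\boldsymbol{\tau}):=\int_\Omega\boldsymbol{\sigma}\cdot\boldsymbol{\tau}\,dx$. Time norms: $\|w\|_{L^p(J;* )}^p:=\int_J\|w(s)\|_*^p\,ds$ for $p\in[1,\infty)$ and $\|w\|_{L^\infty(\overline{J};* )}:=\sup_{s\in\overline{J}}\|w(s)\|_*$.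 $A\lesssim B$ means $A\le C B$ with a generic constant $C>0$ that does not depend on the solution or on the data $u_0$, $f$ (it may depend on $T$). *)

(* Defs.v *)
From HB Require Import structures.
From mathcomp Require Import all_boot all_order all_algebra.
From mathcomp Require Import all_classical all_reals all_analysis.
Set Implicit Arguments.
Unset Strict Implicit.
Unset Printing Implicit Defensive.
Import Order.TTheory GRing.Theory Num.Theory.
Import numFieldNormedType.Exports.
Local Open Scope classical_set_scope.
Local Open Scope ring_scope.

Definition rV_display : measure_display.
Proof. exact: default_measure_display. Qed.

Section measurable_rV.
Context (R : realType) (n : nat).

Let coors : 'I_n -> 'rV[R]_n -> measurableTypeR R := fun i x => x 0 i.

Let rV_set0 : g_sigma_preimage coors set0.
Proof. exact: sigma_algebra0. Qed.

Let rV_setC A : g_sigma_preimage coors A -> g_sigma_preimage coors (~` A).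
Proof. exact: sigma_algebraC. Qed.

Let rV_bigcup (F : _^nat) : (forall i, g_sigma_preimage coors (F i)) ->
  g_sigma_preimage coors (\bigcup_i (F i)).
Proof. exact: sigma_algebra_bigcup. Qed.

(* The product sigma-algebra; on R^n it is also the Borel sigma-algebra. *)
HB.instance Definition _ := @isMeasurable.Build rV_display 'rV[R]_n
  (g_sigma_preimage coors) rV_set0 rV_setC rV_bigcup.

End measurable_rV.

Lemma measurable_coord (R : realType) n (i : 'I_n) :
  measurable_fun [set: 'rV[R]_n] (fun x : 'rV[R]_n => x 0 i).
Proof.
move=> _ Y mY; rewrite setTI; apply: sub_sigma_algebra => /=.
rewrite -bigcup_seq/=; exists i => /=; first by rewrite mem_index_enum.
by exists Y => //; rewrite setTI.
Qed.

Lemma measurable_fun_rV d (T : measurableType d) (R : realType) n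
    (f : T -> 'rV[R]_n) :
  (forall i, measurable_fun [set: T] (fun t => f t 0 i)) ->
  measurable_fun [set: T] f.
Proof.
move=> mf; apply: (@measurability _ _ _ _ setT f _ erefl).
move=> A [B + <-].
rewrite -bigcup_seq/= => -[i _ [C mC <-]].
rewrite !setTI -comp_preimage -[X in measurable X]setTI.
exact: mf.
Qed.

Definition consrV (R : realType) n (p : R * 'rV[R]_n) : 'rV[R]_(1 + n) :=
  row_mx p.1%:M p.2.

Definition unconsrV (R : realType) n (x : 'rV[R]_(1 + n)) : R * 'rV[R]_n :=
  (x 0 0, rsubmx x).

Lemma consrVK (R : realType) n : cancel (@consrV R n) (@unconsrV R n).
Proof.
move=> [a v]; rewrite /unconsrV /consrV row_mxKr; congr pair.
have -> : (0 : 'I_(1 + n)) = lshift n (0 : 'I_1) by exact/val_inj.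
by rewrite row_mxEl mxE eqxx.
Qed.

Lemma measurable_consrV (R : realType) n :
  measurable_fun [set: measurableTypeR R * 'rV[R]_n] (@consrV R n).
Proof.
apply: measurable_fun_rV => i; case: (split_ordP i) => j ->.
- under eq_fun do rewrite row_mxEl ord1 mxE eqxx.
  exact: measurable_fst.
- under eq_fun do rewrite row_mxEr.
  apply: (measurableT_comp (f := fun x : 'rV[R]_n => x 0 j)).
    exact: measurable_coord.
  exact: measurable_snd.
Qed.

Lemma measurable_unconsrV (R : realType) n :
  measurable_fun [set: 'rV[R]_(1 + n)]
    (@unconsrV R n : _ -> measurableTypeR R * 'rV[R]_n).
Proof.
apply/measurable_fun_pair; first exact: measurable_coord.
apply: measurable_fun_rV => i; under eq_fun do rewrite mxE.
exact: measurable_coord.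
Qed.

Section lebesgue_cons.
Context (R : realType) (n : nat).
Variable m : {sigma_finite_measure set 'rV[R]_n -> \bar R}.
Local Open Scope ereal_scope.

Let lebesgue1 : {sigma_finite_measure set (measurableTypeR R) -> \bar R} :=
  lebesgue_measure.

Definition lebesgue_cons : set 'rV[R]_(1 + n) -> \bar R :=
  pushforward (lebesgue1 \x m) (@consrV R n).

Let push : {measure set 'rV[R]_(1 + n) -> \bar R} :=
  measure_function_pushforward__canonical__measure_function_Measure
    (lebesgue1 \x m) (@measurable_consrV R n).

HB.instance Definition _ := Measure.copy lebesgue_cons push.

Lemma lebesgue_consE (A : set (measurableTypeR R)) (B : set 'rV[R]_n) :
  measurable A -> measurable B ->
  lebesgue_cons [set x : 'rV[R]_(1 + n) | A (x 0%R 0%R) /\ B (rsubmx x)]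
  = lebesgue_measure A * m B.
Proof.
move=> mA mB; rewrite -[lebesgue_measure A]/(lebesgue1 A).
rewrite -(product_measure1E lebesgue1 m mA mB) /lebesgue_cons /pushforward.
congr product_measure1; apply/seteqP; split=> -[a v] /=;
  by have [-> ->] : (consrV (a, v)) 0%R 0%R = a /\ rsubmx (consrV (a, v)) = v
    by case: (consrVK (a, v)).
Qed.

Let lebesgue_cons_sigma_finite : sigma_finite setT lebesgue_cons.
Proof.
have /sigma_finiteP[F [TF ndF Foo]] := sigma_finiteT lebesgue1.
have /sigma_finiteP[G [TG ndG Goo]] := sigma_finiteT m.
exists (fun k => [set x : 'rV[R]_(1 + n) | F k (x 0%R 0%R) /\ G k (rsubmx x)]).
  apply/seteqP; split=> // x _.
  have [i _ Fi] : (\bigcup_i F i) (x 0%R 0%R) by rewrite -TF.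
  have [j _ Gj] : (\bigcup_i G i) (rsubmx x) by rewrite -TG.
  exists (maxn i j) => //; split.
  - by move: Fi; exact/subsetPset/ndF/leq_maxl.
  - by move: Gj; exact/subsetPset/ndG/leq_maxr.
move=> k; have [mF Fk] := Foo k; have [mG Gk] := Goo k; split.
  rewrite -[X in measurable X]setTI.
  exact: (measurable_unconsrV measurableT (measurableX mF mG)).
by rewrite lebesgue_consE// lte_mul_pinfty// ge0_fin_numE.
Qed.

HB.instance Definition _ := Measure_isSigmaFinite.Build _ _ _ lebesgue_cons
  lebesgue_cons_sigma_finite.

End lebesgue_cons.

Fixpoint lebesgue_rV (R : realType) (n : nat) :
    {sigma_finite_measure set 'rV[R]_n -> \bar R} :=
  match n with
  | 0 => \d_(0 : 'rV[R]_0)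
  | n'.+1 => lebesgue_cons (lebesgue_rV R n')
  end.

Definition dotv (R : realType) (d : nat) (x y : 'rV[R]_d) : R :=
  \sum_i x 0 i * y 0 i.

(* The boundary, which is [closure Omega `\` Omega] since Omega is open, is
   polygonal or polyhedral: it lies in a finite union of hyperplanes.
   Connectedness follows from convexity. *)
Definition convex_polyhedral_domain (R : realType) (d : nat)
    (Omega : set 'rV[R]_d) : Prop :=
  [/\ open Omega, Omega !=set0, bounded_set Omega,
      convex_set (Omega : set (convex_lmodType 'rV[R]_d)) &
      exists (m : nat) (a : 'I_m -> 'rV[R]_d) (b : 'I_m -> R),
        (forall i, a i != 0) /\
        closure Omega `\` Omega `<=` \bigcup_i [set x | dotv (a i) x = b i]].

Section function_spaces.
Context (R : realType) (d : nat).
Variable Omega : set 'rV[R]_d.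

Local Notation scal := ('rV[R]_d -> R).
Local Notation vect := ('rV[R]_d -> 'rV[R]_d).
Local Notation mu := (lebesgue_rV R d).

(* Functions on Omega are total functions whose values outside Omega are never
   used; [w \_ Omega] is the extension by zero. *)
Definition L2 (w : scal) : Prop := w \_ Omega \in Lfun mu 2%:E.

Definition L2v (tau : vect) : Prop := forall i, L2 (fun x => tau x 0 i).

Definition L2norm (w : scal) : \bar R := 'N[mu]_2%:E[EFin \o (w \_ Omega)]%E.

Definition L2vnorm (tau : vect) : \bar R :=
  L2norm (fun x => Num.sqrt (dotv (tau x) (tau x))).

Definition inner (v w : scal) : R := \int[mu]_(x in Omega) (v x * w x).

Definition innerv (sigma tau : vect) : R :=
  \int[mu]_(x in Omega) dotv (sigma x) (tau x).

Definition partial (i : 'I_d) (f : scal) : scal :=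
  fun x => 'D_(delta_mx 0 i) f x.

Definition grad (f : scal) : vect := fun x => \row_i partial i f x.

Definition smooth (f : scal) : Prop :=
  forall s : seq 'I_d,
    continuous (foldr partial f s) /\
    forall i x, derivable (foldr partial f s) x (delta_mx 0 i).

Definition test_function (theta : scal) : Prop :=
  smooth theta /\
  exists K : set 'rV[R]_d,
    [/\ compact K, K `<=` Omega & forall x, ~ K x -> theta x = 0].

Definition is_weak_div (tau : vect) (q : scal) : Prop :=
  forall theta, test_function theta ->
    innerv tau (grad theta) = - inner q theta.

Definition is_weak_grad (v : scal) (G : vect) : Prop :=
  forall theta, test_function theta -> forall i,
    inner v (partial i theta) = - inner (fun x => G x 0 i) theta.

Definition is_div (tau : vect) (q : scal) : Prop := L2 q /\ is_weak_div tau q.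

Definition Hdiv (tau : vect) : Prop := L2v tau /\ exists q, is_div tau q.

(* The weak divergence, unique up to null sets when [Hdiv tau] *)
Definition wdiv (tau : vect) : scal := get (is_div tau).

Definition H1 (v : scal) (G : vect) : Prop :=
  [/\ L2 v, L2v G & is_weak_grad v G].

(* The normal component tau . n on the boundary, for tau in H(div), is the
   functional on the traces of H^1 given by Green's formula. *)
Definition normal_trace (tau : vect) (v : scal) (G : vect) : R :=
  innerv tau G + inner (wdiv tau) v.

Definition H0div (tau : vect) : Prop :=
  Hdiv tau /\ forall v G, H1 v G -> normal_trace tau v G = 0.

Inductive boundary_case := SimplySupported | CahnHilliard.

Definition Uspace (bc : boundary_case) (v : scal) : Prop :=
  match bc with
  | SimplySupported => L2 v
  | CahnHilliard => L2 v /\ \int[mu]_(x in Omega) v x = 0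
  end.

Definition Mspace (bc : boundary_case) (tau : vect) : Prop :=
  match bc with
  | SimplySupported => Hdiv tau
  | CahnHilliard => H0div tau
  end.

Definition aform (us vt : scal * vect) : R := inner (wdiv us.2) (wdiv vt.2).

Definition bform (vt : scal * vect) (psi : vect) : R :=
  \int[mu]_(x in Omega) (dotv (vt.2 x) (psi x) + vt.1 x * wdiv psi x).

Definition cform (sigma tau : vect) : R := innerv sigma tau.

Variable T : R.

Definition time_Lp_norm (X : Type) (nrm : X -> \bar R) (p : R) (w : R -> X)
    : \bar R :=
  ((\int[lebesgue_measure]_(s in `]0%R, T]%classic) nrm (w s) `^ p) `^ p^-1)%E.

Definition time_Linfty_norm (X : Type) (nrm : X -> \bar R) (w : R -> X)
    : \bar R :=
  ereal_sup [set nrm (w s) | s in `[0, T]].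

Definition time_simple (w : R -> scal) : Prop :=
  exists (m : nat) (A : 'I_m -> set R) (g : 'I_m -> scal),
    (forall i, measurable (A i) /\ L2 (g i)) /\
    forall t x, w t x = \sum_i \1_(A i) t * g i x.

Definition strongly_measurable (w : R -> scal) : Prop :=
  exists s : nat -> R -> scal,
    (forall n, time_simple (s n)) /\
    {ae lebesgue_measure, forall t, t \in `]0, T] ->
      L2norm (s n t \- w t) @[n --> \oo] --> 0%E}.

Definition L2_time_L2 (f : R -> scal) : Prop :=
  [/\ forall t, t \in `]0, T] -> L2 (f t),
      strongly_measurable f & (time_Lp_norm L2norm 2 f < +oo)%E].

(* [dut] is the derivative of u : [0, T] -> L^2(Omega) at time t, the limit of
   the difference quotients in the norm of L^2(Omega), one-sided at t = T *)
Definition is_time_deriv (u : R -> scal) (t : R) (dut : scal) : Prop :=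
  L2 dut /\
  L2norm (fun x => (u s x - u t x) / (s - t) - dut x)
    @[s --> within `[0, T] t^'] --> 0%E.

Definition gfun (r : R) : R := r ^+ 3 - r.

(* The term (g(u), v) needs no integrability assumption: the weak form places
   u(t) in H^1(Omega), hence in L^6(Omega) for d <= 3.
   The initial condition is that of a function continuous at 0 with values in
   L^2(Omega). *)
Definition weak_solution (bc : boundary_case) (gamma : R) (f : R -> scal)
    (u0 : scal) (u : R -> scal) (sigma phi : R -> vect) : Prop :=
  [/\ L2 (u 0) /\ {ae mu, forall x, Omega x -> u 0 x = u0 x},
      L2norm (u t \- u 0) @[t --> 0^'+] --> 0%E &
      forall t, t \in `]0, T] ->
        [/\ Uspace bc (u t), Mspace bc (sigma t), Mspace bc (phi t),
            exists2 dut, is_time_deriv u t dut &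
              forall v tau, Uspace bc v -> Mspace bc tau ->
                inner dut v
                + gamma * (aform (u t, sigma t) (v, tau)
                           + bform (v, tau) (phi t))
                + cform (sigma t) tau + inner (gfun \o u t) v
                = inner (f t) v &
            forall psi, Mspace bc psi -> bform (u t, sigma t) psi = 0]].

End function_spaces.

(* Main.v *)
Require Import Defs.
From mathcomp Require Import all_boot all_order all_algebra.
From mathcomp Require Import all_classical all_reals all_analysis.
From mathcomp Require Import measurable_realfun ring lra.
Set Implicit Arguments.
Unset Strict Implicit.
Unset Printing Implicit Defensive.
Import Order.TTheory GRing.Theory Num.Theory.
Import numFieldNormedType.Exports.
Local Open Scope classical_set_scope.
Local Open Scope ring_scope.

(** The estimate is the energy identity of the gradient flow.  Testing the weak
    form with (v, tau) = (u(t), sigma(t)) and the constraint with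
    psi = phi(t), the coupling term b((u, sigma), phi) drops out; and
    (g(u), u) = |u|_4^4 - |u|^2 >= - |u|^2, so that y(t) = |u(t)|^2 satisfies
      y' + 2 (gamma |div sigma|^2 + |sigma|^2) <= 3 y + |f|^2
    at every t in (0, T] ([weak_solution_energy]).  Multiplying by the
    integrating factor exp(3 (T - t)) >= 1 and integrating bounds y(b) and the
    dissipated energy by exp(3 T) (|u_0|^2 + int |f|^2)
    ([gronwall_dissipation]).

    What needs care is the integration.  The solution is only differentiable at
    each time, without any integrability of the derivative, so the fundamental
    theorem of calculus does not apply to y; moreover |f(t)|^2 agrees with a
    measurable function only almost everywhere, and t |-> |div sigma(t)|^2 and
    t |-> |sigma(t)|^2 are not known to be measurable.  Three facts replace it.
    - A function with a finite derivative at every point, bounded almost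
      everywhere by an integrable phi, grows at most by the integral of phi
      ([growth_le_integral]).  At almost every t the primitive of phi has
      derivative phi(t), by Lebesgue's differentiation theorem; on the
      remaining null set it is corrected by a nondecreasing function of
      arbitrarily small total variation that grows infinitely fast there
      ([null_set_steep]).  The comparison then only involves right Dini
      derivatives ([growth_le]).
    - The integral of a nonnegative function that may fail to be measurable is
      the supremum of the integrals of the simple functions below it.  For each
      bounded simple function h below the dissipation, the growth bound applies
      to phi - h up to a constant, and the supremum over h can be taken
      afterwards ([growth_le_lower_integral]).
    - Strong measurability of f makes |f(t)|^2 equal, off a null set, to a
      measurable function that lies below it everywhere
      ([L2_time_L2_measurable_version]).

    Everything about L^2(Omega) is expressed through extensions by zero, so
    that Omega enters only as a set on which functions are restricted. *)

Import HBNNSimple.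

(** * Growth of functions with an integrable bound on the derivative *)

(** Real induction: the set of x where the bound z x - z a <= theta x - theta a
    holds contains its supremum, by left continuity of z and monotonicity of
    theta, and the right condition pushes it further.  Jumps of theta only
    make the bound weaker on the right. *)
Lemma growth_le (R : realType) (z theta : R -> R) (a b : R) : a <= b ->
  (forall t, a <= t < b ->
    \forall s \near t^'+, z s - z t <= theta s - theta t) ->
  (forall t, a < t <= b -> z s @[s --> t^'-] --> z t) ->
  {homo theta : x y / x <= y} ->
  z b - z a <= theta b - theta a.
Proof.
move=> ab dini lcont thetaND.
pose S := [set x | a <= x <= b /\ z x - z a <= theta x - theta a].
have Sa : S a by split; rewrite ?lexx ?ab// !subrr.
have ubS : ubound S b by move=> x [/andP[]].
have supS : has_sup S by split; [exists a|exists b].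
pose c := sup S.
have ac : a <= c by apply: ub_le_sup => //; exists b.
have cb : c <= b by apply: ge_sup => //; exists a.
have [_ Sc] : S c.
  split; first by rewrite ac.
  move: ac; rewrite le_eqVlt => /predU1P[<-|ac]; first by rewrite !subrr.
  apply/ler_addgt0Pr => e e0.
  have /cvgrPdist_lt/(_ e e0) : z s @[s --> c^'-] --> z c.
    by apply: lcont; rewrite ac.
  move=> [d /= d0 ball_d].
  have [s Ss cds] := sup_adherent d0 supS.
  have sc : s <= c by apply: ub_le_sup => //; exists b.
  case: Ss => _; move: sc; rewrite le_eqVlt => /predU1P[->|sc] Ss.
    by rewrite (le_trans Ss)// lerDl ltW.
  have /= := ball_d s; rewrite gtr0_norm ?subr_gt0// => /(_ _ sc).
  rewrite ltrBlDl => /(_ _)/(le_lt_trans (ler_norm _)) zcs.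
  have {}zcs : z c - z s < e by apply: zcs; rewrite addrC -ltrBlDl.
  by have := thetaND _ _ (ltW sc); lra.
move: cb; rewrite le_eqVlt => /predU1P[<-//|cb].
have : \forall s \near c^'+, c < s <= b /\ z s - z c <= theta s - theta c.
  near=> s; split.
    apply/andP; split; first by near: s; exact: nbhs_right_gt.
    by near: s; exact: nbhs_right_le.
  by near: s; apply: dini; rewrite ac.
move=> /filter_ex[s [/andP[cs sb] zs]].
have Ss : S s by split; [rewrite sb (le_trans ac)// ltW|lra].
have : s <= c by apply: ub_le_sup => //; exists b.
by rewrite leNgt cs.
Unshelve. all: by end_near. Qed.

(** Psi x is the total mass in ]-oo, x] of the restrictions of the Lebesgue
    measure to open sets V_k that contain N and have mass at most e / 2^(k+1).
    To the right of a point of N, n of the V_k contain a common interval, on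
    which Psi has slope at least n. *)
Lemma null_set_steep (R : realType) (N : set R) (e : R) :
  lebesgue_measure.-negligible N -> 0 < e ->
  exists Psi : R -> R, [/\ {homo Psi : x y / x <= y},
    forall x, 0 <= Psi x <= e &
    forall t M, N t -> \forall s \near t^'+, M * (s - t) <= Psi s - Psi t].
Proof.
move=> [A [mA A0 NA]] e0.
have /choice[V HV] : forall k, exists V : set R, [/\ open V, N `<=` V &
    (lebesgue_measure V <= (e / (2 ^ k.+1)%:R)%:E)%E].
  move=> k; have ek0 : 0 < e / (2 ^ k.+1)%:R by rewrite divr_gt0// ltr0n expn_gt0.
  have Aoo : (lebesgue_measure A < +oo)%E by rewrite A0.
  have [U [oU AU Ue]] := lebesgue_regularity_outer mA Aoo ek0.
  exists U; split => //; first exact: subset_trans AU.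
  have mU := open_measurable oU.
  rewrite -(setDKU AU) measureU//; last 2 first.
  - exact: measurableD.
  - by rewrite setDE -setIA setICl setI0.
  by rewrite [X in (_ + X)%E]A0 adde0 ltW.
have mV k : measurable (V k) by have [? _ _] := HV k; exact: open_measurable.
pose nu := mseries (fun k => mrestr lebesgue_measure (mV k)) 0.
have nuT : (nu [set: R] <= e%:E)%E.
  apply: le_trans (epsilon_trick0 xpredT (ltW e0)).
  apply: lee_nneseries => k *; first exact: measure_ge0.
  by have [_ _] := HV k; rewrite -[X in lebesgue_measure X](setTI (V k)).
have nu_le B : measurable B -> (nu B <= e%:E)%E.
  by move=> mB; apply: le_trans nuT; apply: le_measure; rewrite ?inE.
have nu_fin B : measurable B -> nu B \is a fin_num.
  move=> mB; rewrite ge0_fin_numE ?measure_ge0//.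
  by rewrite (le_lt_trans (nu_le _ mB))// ltry.
pose Psi (x : R) := fine (nu `]-oo, x]%classic).
have PsiD x y : x <= y -> Psi y - Psi x = fine (nu `]x, y]%classic).
  move=> xy; have -> : Psi y = fine (nu `]-oo, x]%classic + nu `]x, y]%classic)%E.
    congr fine; rewrite -measureU//.
      congr (nu _); rewrite -itv_bndbnd_setU//.
    rewrite -subset0 => u /= []; rewrite !in_itv/= => ux /andP[+ _].
    by rewrite ltNge ux.
  by rewrite fineD ?nu_fin// addrAC subrr add0r.
exists Psi; split.
- by move=> x y xy; rewrite -subr_ge0 PsiD// fine_ge0.
- by move=> x; rewrite fine_ge0//= -lee_fin fineK ?nu_fin// nu_le.
- move=> t M Nt; pose n := (Num.truncn `|M|).+1.
  have Mn : M <= n%:R by rewrite (le_trans (ler_norm _))// ltW// truncnS_gt.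
  (* finitely many of the open sets contain a common interval ]t, s] *)
  have near_sub : \forall s \near t^'+,
      forall k, (k < n)%N -> `]t, s]%classic `<=` V k.
    elim: n {Mn} => [|n IH]; first by near=> s.
    have [oV NV _] := HV n.
    have /nbhs_ballP[d /= d0 bd] : nbhs t (V n).
      by move: oV; rewrite openE => /(_ t (NV _ Nt)).
    near=> s.
    have subn : forall k, (k < n)%N -> `]t, s]%classic `<=` V k by near: s.
    have st : s < t + d by near: s; apply: nbhs_right_lt; rewrite ltrDl.
    move=> k; rewrite ltnS leq_eqVlt => /predU1P[->|]; last exact: subn.
    move=> u /=; rewrite in_itv/= => /andP[tu us]; apply: bd.
    by rewrite /ball/= ltr0_norm ?subr_lt0//; lra.
  near=> s.
  have ts : t <= s by near: s; exact: nbhs_right_ge.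
  have sub_s : forall k, (k < n)%N -> `]t, s]%classic `<=` V k by near: s.
  rewrite PsiD// -lee_fin fineK ?nu_fin//.
  apply: (@le_trans _ _ (\sum_(0 <= k < n)
      lebesgue_measure (`]t, s]%classic `&` V k))%E).
    rewrite (eq_big_nat _ _ (F2 := fun=> (s - t)%:E)).
      rewrite sumEFin lee_fin sumr_const_nat subn0 -mulr_natl.
      by rewrite ler_wpM2r// subr_ge0.
    move=> k /andP[_ kn]; have -> : `]t, s]%classic `&` V k = `]t, s]%classic.
      by apply/setIidPl; exact: sub_s.
    rewrite lebesgue_measure_itv/= lte_fin EFinB.
    by move: ts; rewrite le_eqVlt => /predU1P[->|->//]; rewrite ltxx subee.
  apply: nneseries_lim_ge => k _ _; exact: measure_ge0.
Unshelve. all: by end_near. Qed.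

Lemma is_derive_right_growth (R : realType) (w : R -> R) (t l k : R) :
  is_derive t 1 w l -> l < k -> \forall s \near t^'+, w s - w t <= k * (s - t).
Proof.
move=> /is_derive1_caratheodory[g [wE cg gt]] lk.
have g_lt : \forall s \near t, g s < k by apply: (cvgr_lt _ cg); rewrite gt.
near=> s; have ts : t <= s by near: s; exact: nbhs_right_ge.
rewrite wE ler_wpM2r ?subr_ge0//.
by apply: ltW; near: s; exact: cvg_within g_lt.
Unshelve. all: by end_near. Qed.

(** z is compared with theta = Phi + e Psi + e id, where Phi is the primitive of
    phi and Psi is steep on the null set N on which Phi' = phi or the bound on
    dz fails.  Off N the slack e id absorbs the error of the difference
    quotient; on N the finite number dz t is beaten by the infinite slope of
    Psi. *)
Lemma growth_le_integral (R : realType) (z dz phi : R -> R) (a b : R) :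
  a < b ->
  z s @[s --> a^'+] --> z a ->
  (forall t, a < t <= b -> z s @[s --> t^'-] --> z t) ->
  (forall t, a < t < b -> is_derive t 1 z (dz t)) ->
  (forall t, 0 <= phi t) ->
  lebesgue_measure.-integrable [set: R] (EFin \o phi) ->
  {ae lebesgue_measure, forall t, a < t < b -> dz t <= phi t} ->
  z b - z a <= \int[lebesgue_measure]_(t in `]a, b]) phi t.
Proof.
move=> ab rcont lcont dzE phi0 iphi dzphi.
have iphiS (A : set R) : measurable A ->
    lebesgue_measure.-integrable A (EFin \o phi).
  by move=> mA; apply: integrableS iphi.
pose Phi x := \int[lebesgue_measure]_(t in `]-oo, x]) phi t.
have PhiD x y : x <= y ->
    Phi y = Phi x + \int[lebesgue_measure]_(t in `]x, y]) phi t.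
  move=> xy; rewrite /Phi -Rintegral_setU//.
  - by rewrite -itv_bndbnd_setU.
  - exact/iphiS/measurableU.
  - apply/disj_setPS => u /= []; rewrite !in_itv/= => ux /andP[+ _].
    by rewrite ltNge ux.
have PhiND : {homo Phi : x y / x <= y}.
  by move=> x y xy; rewrite (PhiD _ _ xy) lerDl Rintegral_ge0.
have -> : \int[lebesgue_measure]_(t in `]a, b]) phi t = Phi b - Phi a.
  by rewrite (PhiD _ _ (ltW ab)) addrAC subrr add0r.
have dPhi : {ae lebesgue_measure, forall t : R, is_derive (t : R) 1 Phi (phi t)}.
  have locphi := open_integrable_locally openT iphi.
  have := FTC1Ny (fun y => iphiS `]-oo, y]%classic (measurable_itv _)) locphi.
  apply: filterS; first exact: (ae_filter_ringOfSetsType lebesgue_measure).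
  move=> t [dP P']; split => //.
  by rewrite -derive1E P'.
have [N /= [mN N0 NP]] :=
  @filterI _ _ (ae_filter_ringOfSetsType lebesgue_measure) _ _ dPhi dzphi.
have {}NP t : ~ N t -> is_derive t 1 Phi (phi t) /\ (a < t < b -> dz t <= phi t).
  by move=> Nt; apply: contrapT => ?; exact/Nt/NP.
have negN : lebesgue_measure.-negligible N by exists N; split.
have [Psi [PsiND Psi01 PsiN]] := null_set_steep negN ltr01.
have slope e : 0 < e -> z b - z a <= Phi b - Phi a + e * (1 + (b - a)).
  move=> e0; pose theta x := Phi x + e * Psi x + e * x.
  have thetaND : {homo theta : x y / x <= y}.
    move=> x y xy; rewrite /theta !lerD//; first exact: PhiND.
      exact/(ler_wpM2l (ltW e0))/PsiND.
    exact: ler_wpM2l (ltW e0) _ _ xy.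
  have step c : a < c < b -> z b - z c <= Phi b - Phi a + e * (1 + (b - a)).
    move=> /andP[ac cb].
    have : z b - z c <= theta b - theta c.
      apply: growth_le (ltW cb) _ _ thetaND => t /andP[ct tb]; last first.
        by apply: lcont; rewrite (lt_trans ac).
      have atb : a < t < b by rewrite (lt_le_trans ac).
      have [Nt|/NP[dPhit /(_ atb) dzt]] := pselect (N t).
        (* t lies in N: the slope of Psi beats (|dz t| + 1) / e *)
        have zt : dz t < `|dz t| + 1.
          by rewrite (le_lt_trans (ler_norm _))// ltrDl.
        near=> s.
        have ts : t <= s by near: s; exact: nbhs_right_ge.
        have zs : z s - z t <= (`|dz t| + 1) * (s - t).
          by near: s; exact: is_derive_right_growth (dzE _ atb) zt.
        have Ps : (`|dz t| + 1) / e * (s - t) <= Psi s - Psi t.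
          by near: s; exact: PsiN.
        have := ler_wpM2l (ltW e0) Ps.
        rewrite mulrA mulrC mulrA mulrACA divff ?gt_eqF// mulr1 => {}Ps.
        have := PhiND _ _ ts; have := ler_wpM2l (ltW e0) ts.
        by rewrite /theta; lra.
      (* t lies off N, where z - Phi has a derivative <= 0 *)
      have dw : is_derive t 1 (z - Phi) (dz t - phi t).
        by apply: is_deriveB; exact: dzE.
      have lt0 : dz t - phi t < e by lra.
      near=> s.
      have ts : t <= s by near: s; exact: nbhs_right_ge.
      have : (z - Phi) s - (z - Phi) t <= e * (s - t).
        by near: s; exact: is_derive_right_growth dw lt0.
      have := ler_wpM2l (ltW e0) (PsiND _ _ ts).
      by rewrite /theta !fctE; lra.
    have := PhiND _ _ (ltW ac); have /andP[_ Pb] := Psi01 b.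
    have /andP[Pc _] := Psi01 c; rewrite /theta.
    by have := ler_wpM2l (ltW e0) Pb; have := ler_wpM2l (ltW e0) Pc;
      have := ler_wpM2l (ltW e0) (ltW ac); lra.
  (* the derivative is not controlled at a: let c tend to a from the right *)
  apply/ler_addgt0Pr => r r0.
  have : \forall c \near a^'+, a < c < b /\ `|z a - z c| < r.
    near=> c; split; last by near: c; move/cvgrPdist_lt : rcont; exact.
    apply/andP; split; first by near: c; exact: nbhs_right_gt.
    by near: c; exact: nbhs_right_lt.
  move=> /filter_ex[c [/step zc]]; rewrite ltr_norml => /andP[? ?]; lra.
apply/ler_addgt0Pr => r r0.
have c0 : 0 < 1 + (b - a) by lra.
by have := slope _ (divr_gt0 r0 c0); rewrite divfK ?gt_eqF.
Unshelve. all: by end_near. Qed.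

(** * Integrals of possibly nonmeasurable nonnegative functions *)

(** This holds for arbitrary functions: the simple functions below f are among
    those below g. *)
Lemma le_lower_integral d (T : measurableType d) (R : realType)
    (mu : {measure set T -> \bar R}) (D : set T) (f g : T -> \bar R) :
  (forall x, D x -> 0 <= f x <= g x)%E ->
  (\int[mu]_(x in D) f x <= \int[mu]_(x in D) g x)%E.
Proof.
move=> fg.
have f0 x : D x -> (0 <= f x)%E by move=> /fg/andP[].
have g0 x : D x -> (0 <= g x)%E by move=> /fg/andP[]; exact: le_trans.
rewrite !ge0_integralE//; apply: le_ereal_sup => _ [h hf <-].
exists h => // x; apply: le_trans (hf x) _; rewrite !patchE.
by case: ifPn => // /[!inE] /fg/andP[].
Qed.

Lemma lower_integral_le d (T : measurableType d) (R : realType)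
    (mu : {measure set T -> \bar R}) (D : set T) (f : T -> \bar R) (c : \bar R) :
  (forall x, D x -> 0 <= f x)%E ->
  (forall h : {nnsfun T >-> R}, (forall x, D x -> (h x)%:E <= f x)%E ->
    (forall x, ~ D x -> h x = 0) -> (\int[mu]_x (h x)%:E <= c)%E) ->
  (\int[mu]_(x in D) f x <= c)%E.
Proof.
move=> f0 hc; rewrite ge0_integralE//; apply: ge_ereal_sup => _ [h hf <-].
rewrite -integralT_nnsfun; apply: hc => x Dx; have := hf x; rewrite patchE.
  by rewrite mem_set.
rewrite memNset// lee_fin => h0; apply/eqP; rewrite eq_le h0/=; exact: fun_ge0.
Qed.

(** For a simple function h <= M below D, the growth bound is applied to
    z + M id, whose derivative is at most phi + (M - h): the shift by M makes
    this integrand nonnegative, and contributes M (b - a) on both sides. *)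
Lemma growth_le_lower_integral (R : realType) (z dz phi D : R -> R) (a b : R) :
  a < b ->
  z s @[s --> a^'+] --> z a ->
  (forall t, a < t <= b -> z s @[s --> t^'-] --> z t) ->
  (forall t, a < t < b -> is_derive t 1 z (dz t)) ->
  (forall t, 0 <= phi t) ->
  lebesgue_measure.-integrable `]a, b] (EFin \o phi) ->
  (forall t, a < t <= b -> 0 <= D t) ->
  {ae lebesgue_measure, forall t, a < t < b -> dz t + D t <= phi t} ->
  ((z b - z a)%:E + \int[lebesgue_measure]_(t in `]a, b]) (D t)%:E <=
    \int[lebesgue_measure]_(t in `]a, b]) (phi t)%:E)%E.
Proof.
move=> ab rcont lcont dzE phi0 iphi D0 dzphi.
pose I := \int[lebesgue_measure]_(t in `]a, b]) phi t.
have IE : (\int[lebesgue_measure]_(t in `]a, b]) (phi t)%:E)%E = I%:E.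
  by rewrite /I /Rintegral fineK// integrable_fin_num.
rewrite IE addeC -leeBrDr// -EFinB.
apply: lower_integral_le => [t /=|h hD h0].
  by rewrite in_itv/= lee_fin; exact: D0.
have [M0 [_ hM0]] := simple_bounded h.
pose M : R := `|M0| + 1.
have hM t : h t <= M.
  rewrite (le_trans (ler_norm _))// hM0 ?inE// /M (le_lt_trans (ler_norm M0))//.
  by rewrite ltrDl.
have mlt : (lebesgue_measure (`]a, b]%classic : set R) < +oo)%E.
  by rewrite lebesgue_measure_itv/= lte_fin ab ltry.
have mh : measurable_fun [set: measurableTypeR R] h by exact: measurable_funPT.
have ih : lebesgue_measure.-integrable `]a, b] (EFin \o h).
  apply: measurable_bounded_integrable => //; first exact: measurable_funTS.
  by exists M0; split; [exact: num_real|move=> x /hM0 + y _; apply].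
have iM : lebesgue_measure.-integrable `]a, b] (EFin \o cst M).
  apply: measurable_bounded_integrable => //.
  exists M; split; first exact: num_real.
  by move=> x /ltW + y _ /=; rewrite ger0_norm// addr_ge0.
rewrite [leLHS](_ : _ = (\int[lebesgue_measure]_(t in `]a, b]) h t)%:E); last first.
  rewrite /Rintegral fineK ?integrable_fin_num// [RHS]integral_mkcond.
  apply: eq_integral => t _; rewrite patchE; case: ifPn => //.
  by rewrite notin_setE => /h0 ->.
pose g t := phi t + (M - h t).
have mab : measurable (`]a, b]%classic : set (measurableTypeR R)) by [].
have ig : lebesgue_measure.-integrable `]a, b] (EFin \o g).
  have i1 := integrableB mab iM ih.
  have i2 := integrableD mab iphi i1.
  exact: i2.
pose psi := g \_ `]a, b].
have psi0 t : 0 <= psi t.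
  by rewrite /psi patchE; case: ifPn => // _; rewrite addr_ge0// subr_ge0.
have ipsi : lebesgue_measure.-integrable [set: R] (EFin \o psi).
  rewrite /psi -restrict_EFin.
  exact: (iffLR (integrable_mkcond _ mab) ig).
have psiE t : a < t <= b -> psi t = g t.
  by move=> tab; rewrite /psi patchE mem_set//= in_itv.
have -> : \int[lebesgue_measure]_(t in `]a, b]) h t = I + M * (b - a) -
    \int[lebesgue_measure]_(t in `]a, b]) psi t.
  have -> : \int[lebesgue_measure]_(t in `]a, b]) psi t =
      \int[lebesgue_measure]_(t in `]a, b]) g t.
    by apply: eq_Rintegral => t; rewrite inE/= in_itv/=; exact: psiE.
  rewrite RintegralD//; last exact: (integrableB mab iM ih).
  rewrite RintegralB// Rintegral_cst//.
  rewrite (_ : fine _ = b - a); last first.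
    by rewrite [X in fine X]lebesgue_measure_itv/= lte_fin ab.
  by rewrite /I; ring.
rewrite lee_fin.
have linc : continuous (M \*: @id R).
  by move=> t; apply: cvgZr; exact: cvg_id.
have : (z + M \*: id) b - (z + M \*: id) a <=
    \int[lebesgue_measure]_(t in `]a, b]) psi t.
  apply: (@growth_le_integral _ _ (fun t => dz t + M *: 1)) => //.
  - by apply: cvgD => //; apply: cvg_at_right_filter; exact: linc.
  - move=> t tab; apply: cvgD; first exact: lcont.
    by apply: cvg_at_left_filter; exact: linc.
  - by move=> t /dzE ?; apply: is_deriveD.
  - apply: filterS dzphi; first exact: (ae_filter_ringOfSetsType lebesgue_measure).
    move=> t dzt /andP[ta tb].
    have : `]a, b]%classic t by rewrite /= in_itv/= ta ltW.
    move=> /hD; rewrite lee_fin => hDt.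
    have tab : a < t <= b by rewrite ta ltW.
    rewrite psiE// /g -[M *: 1]/(M * 1) mulr1.
    by have := dzt; rewrite ta tb => /(_ isT); lra.
move: (\int[lebesgue_measure]_(t in _) psi t) => J.
by rewrite !fctE /= -[M *: b]/(M * b) -[M *: a]/(M * a); lra.
Qed.

Lemma poweR2 (R : realType) (x : \bar R) : (0 <= x)%E -> (x `^ 2 = x ^+ 2)%E.
Proof.
case: x => [x| |]//; last by move=> _; rewrite poweRyr// expe2 mulyy.
by rewrite lee_fin poweR_EFin => x0; rewrite powR_mulrn// EFin_expe.
Qed.

Lemma sqr_poweRV2 (R : realType) (x : \bar R) :
  (0 <= x)%E -> ((x `^ 2^-1) ^+ 2 = x)%E.
Proof. by move=> x0; rewrite -poweR2 ?poweR_ge0// -poweRrM mulVf// poweRe1. Qed.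

(** * The inner product of L^2(Omega) *)

Section L2_inner.
Context (R : realType) (d : nat) (Omega : set 'rV[R]_d).
Implicit Types v w g : 'rV[R]_d -> R.
Local Notation mu := (lebesgue_rV R d).

Lemma inner_restrict v w :
  inner Omega v w = \int[mu]_x ((v \_ Omega) x * (w \_ Omega) x).
Proof.
rewrite /inner Rintegral_mkcond; apply: eq_Rintegral => x _.
by rewrite !patchE; case: ifPn => // _; rewrite mulr0.
Qed.

Lemma L2_integrableM v w : L2 Omega v -> L2 Omega w ->
  mu.-integrable setT (EFin \o (fun x => (v \_ Omega) x * (w \_ Omega) x)).
Proof. by move=> v2 w2; apply/Lfun1_integrable/Lfun2_mul_Lfun1. Qed.

Lemma L2_lin a b v w : L2 Omega v -> L2 Omega w ->
  L2 Omega (fun x => a * v x + b * w x).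
Proof.
move=> v2 w2; rewrite /L2.
have -> : (fun x => a * v x + b * w x) \_ Omega =
    (a \o* (v \_ Omega)) + (b \o* (w \_ Omega)).
  apply/funext => x; rewrite !fctE /= !patchE; case: ifPn => _.
    by rewrite (mulrC a) (mulrC b).
  by rewrite !mul0r addr0.
apply: (Lfun_addr_closed mu (lee1n 2)).2; apply: Lfun_scale => //.
- by rewrite ler1n.
- by rewrite ler1n.
Qed.

Lemma innerC v w : inner Omega v w = inner Omega w v.
Proof. by apply: eq_Rintegral => x _; rewrite mulrC. Qed.

Lemma inner_linl a b v w g : L2 Omega v -> L2 Omega w -> L2 Omega g ->
  inner Omega (fun x => a * v x + b * w x) g =
  a * inner Omega v g + b * inner Omega w g.
Proof.
move=> v2 w2 g2; rewrite !inner_restrict.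
have vg := L2_integrableM v2 g2; have wg := L2_integrableM w2 g2.
rewrite -!RintegralZl// -RintegralD//; last 2 first.
- exact: (integrableZl measurableT a vg).
- exact: (integrableZl measurableT b wg).
apply: eq_Rintegral => x _; rewrite !patchE; case: ifPn => _; last first.
  by rewrite !mulr0 addr0.
by ring.
Qed.

Lemma inner_linr a b v w g : L2 Omega v -> L2 Omega w -> L2 Omega g ->
  inner Omega g (fun x => a * v x + b * w x) =
  a * inner Omega g v + b * inner Omega g w.
Proof. by move=> *; rewrite ![inner Omega g _]innerC inner_linl. Qed.

Lemma inner_ge0 v : 0 <= inner Omega v v.
Proof. by apply: Rintegral_ge0 => x _; rewrite -expr2 sqr_ge0. Qed.

Lemma L2norm_sqr_integral v :
  (L2norm Omega v ^+ 2 = \int[mu]_(x in Omega) (v x ^+ 2)%:E)%E.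
Proof.
rewrite /L2norm unlock sqr_poweRV2; last first.
  by apply: integral_ge0 => x _; exact: poweR_ge0.
rewrite [RHS]integral_mkcond; apply: eq_integral => x _.
rewrite poweR2// -EFin_expe /= -normrX ger0_norm ?sqr_ge0// !patchE.
by case: ifPn => // _; rewrite expr0n.
Qed.

Lemma L2norm_sqr v : L2 Omega v -> (L2norm Omega v ^+ 2 = (inner Omega v v)%:E)%E.
Proof.
move=> v2; have iv := L2_integrableM v2 v2.
rewrite L2norm_sqr_integral inner_restrict /Rintegral fineK ?integrable_fin_num//.
rewrite [LHS]integral_mkcond; apply: eq_integral => x _; rewrite !patchE.
by case: ifPn => // _; rewrite mulr0.
Qed.

Lemma L2vnorm_sqr (tau : 'rV[R]_d -> 'rV[R]_d) : L2v Omega tau ->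
  (L2vnorm Omega tau ^+ 2 = (innerv Omega tau tau)%:E)%E.
Proof.
move=> tau2; rewrite /L2vnorm L2norm_sqr_integral /innerv /Rintegral.
have dotv_ge0 x : 0 <= dotv (tau x) (tau x).
  by apply: sumr_ge0 => i _; rewrite -expr2 sqr_ge0.
have -> : (\int[mu]_(x in Omega) (Num.sqrt (dotv (tau x) (tau x)) ^+ 2)%:E =
    \int[mu]_(x in Omega) (dotv (tau x) (tau x))%:E)%E.
  by apply: eq_integral => x _; rewrite sqr_sqrtr.
pose tau_ i := (fun x => tau x 0 i) \_ Omega.
have itau : mu.-integrable setT
    (fun x => \sum_(i <- index_enum 'I_d) (EFin \o (tau_ i \* tau_ i)%R) x)%E.
  by apply: integrable_sum => // i _; exact: L2_integrableM (tau2 i) (tau2 i).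
have -> : (\int[mu]_(x in Omega) (dotv (tau x) (tau x))%:E = \int[mu]_x
    \sum_(i <- index_enum 'I_d) (EFin \o (tau_ i \* tau_ i)%R) x)%E.
  rewrite [LHS]integral_mkcond; apply: eq_integral => x _.
  rewrite patchE /= sumEFin; case: ifPn => xO.
    by congr EFin; apply: eq_bigr => i _; rewrite /tau_ patchE xO.
  by rewrite big1// => i _; rewrite /tau_ patchE (negbTE xO) mulr0.
by rewrite fineK// integrable_fin_num.
Qed.

Lemma L2normE v : L2 Omega v -> L2norm Omega v = (Num.sqrt (inner Omega v v))%:E.
Proof.
move=> v2; have := L2norm_sqr v2.
have : (0 <= L2norm Omega v)%E by exact: Lnorm_ge0.
case: (L2norm Omega v) => [x| |]//.
by rewrite lee_fin -EFin_expe => x0 -[<-]; rewrite sqrtr_sqr ger0_norm.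
Qed.

Lemma inner_cauchy_schwarz v w : L2 Omega v -> L2 Omega w ->
  `|inner Omega v w| <= Num.sqrt (inner Omega v v) * Num.sqrt (inner Omega w w).
Proof.
move=> v2 w2; rewrite -lee_fin EFinM -!L2normE// inner_restrict.
have ivw := L2_integrableM v2 w2.
apply: (@le_trans _ _ ('N[mu]_1[EFin \o ((v \_ Omega) \* (w \_ Omega))%R])%E).
  rewrite Lnorm1 EFin_normr_Rintegral//.
  by apply: le_abse_integral => //; case/integrableP : ivw.
have /andP[+ _] := v2; have /andP[+ _] := w2; rewrite !inE/= => mw mv.
by apply: (@hoelder _ _ _ _ _ _ 2 2) => //; rewrite [RHS]splitr !div1r.
Qed.

Lemma ae_eq_inner v w : {ae mu, forall x, Omega x -> v x = w x} ->
  L2 Omega v -> L2 Omega w -> inner Omega v v = inner Omega w w.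
Proof.
move=> vw v2 w2; rewrite !inner_restrict; congr fine.
apply: ae_eq_integral => //.
- by have /integrableP[] := L2_integrableM v2 v2.
- by have /integrableP[] := L2_integrableM w2 w2.
- apply: filterS vw => x vwx _; rewrite !patchE; case: ifPn => // /[!inE] Ox.
  by rewrite vwx.
Qed.

End L2_inner.

(** * Functions of time with values in L^2(Omega) *)

Section L2_time.
Context (R : realType) (d : nat) (Omega : set 'rV[R]_d).
Implicit Types u f : R -> 'rV[R]_d -> R.
Local Notation L2 := (L2 Omega).
Local Notation inner := (inner Omega).
Local Notation sqn v := (Num.sqrt (inner v v)).

Lemma L2_sub v w : L2 v -> L2 w -> L2 (v \- w).
Proof.
move=> v2 w2; have := L2_lin 1 (-1) v2 w2; congr (Defs.L2 _ _).
by apply/funext => x; rewrite mul1r mulN1r.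
Qed.

Lemma inner_sqr_lin a b v w : L2 v -> L2 w ->
  inner (fun x => a * v x + b * w x) (fun x => a * v x + b * w x) =
  a ^+ 2 * inner v v + 2 * a * b * inner v w + b ^+ 2 * inner w w.
Proof.
move=> v2 w2; have vw2 := L2_lin a b v2 w2.
rewrite inner_linl// !inner_linr// (innerC Omega w v); ring.
Qed.

Lemma inner_sqr_triangle v w : L2 v -> L2 w ->
  inner (v \+ w) (v \+ w) <= (sqn v + sqn w) ^+ 2.
Proof.
move=> v2 w2; have := inner_sqr_lin 1 1 v2 w2.
have -> : (fun x => 1 * v x + 1 * w x) = v \+ w.
  by apply/funext => x; rewrite !mul1r.
move=> ->; have := inner_cauchy_schwarz v2 w2; rewrite ler_norml => /andP[_].
by rewrite sqrrD !sqr_sqrtr ?inner_ge0//; lra.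
Qed.

(** With q_s the difference quotient of u minus dut, which tends to 0 in norm,
    u s = u t + (s - t) (q_s + dut), whence the difference quotient of |u|^2
    differs from 2 (dut, u t) by 2 (q_s, u t) + (s - t) |q_s + dut|^2. *)
Lemma is_time_deriv_inner (T t : R) u dut :
  (forall s, s \in `[0, T] -> L2 (u s)) -> t \in `[0, T] ->
  is_time_deriv Omega T u t dut ->
  (inner (u s) (u s) - inner (u t) (u t)) / (s - t)
    @[s --> within `[0, T] t^'] --> 2 * inner dut (u t).
Proof.
move=> u2 tT [dut2 qcvg].
pose q s x := (u s x - u t x) / (s - t) - dut x.
have q2 s : s \in `[0, T] -> L2 (q s).
  move=> sT; have := L2_lin (s - t)^-1 (-1) (L2_sub (u2 _ sT) (u2 _ tT)) dut2.
  by congr (Defs.L2 _ _); apply/funext => x; rewrite /q /= mulN1r mulrC.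
pose n s := fine (L2norm Omega (q s)).
have n0 : n s @[s --> within `[0, T] t^'] --> (0 : R) by exact: fine_cvg qcvg.
have nE s : s \in `[0, T] -> n s = sqn (q s) by move=> /q2 ?; rewrite /n L2normE.
pose B s := 2 * (n s * sqn (u t)) + `|s - t| * (n s + sqn dut) ^+ 2.
have dist0 : `|s - t| @[s --> within `[0, T] t^'] --> (0 : R).
  do 2 apply: cvg_within_filter.
  have : (fun s => `|s - t|) @ t --> `|t - t|.
    by apply: cvg_norm; apply: cvgB; [exact: cvg_id|exact: cvg_cst].
  by rewrite subrr normr0.
have B0 : B s @[s --> within `[0, T] t^'] --> (0 : R).
  have nd : n s + sqn dut @[s --> within `[0, T] t^'] --> 0 + sqn dut.
    exact: cvgD n0 (cvg_cst _).
  have B1 : 2 * (n s * sqn (u t)) @[s --> within `[0, T] t^'] -->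
      2 * (0 * sqn (u t)).
    by apply: cvgM; [exact: cvg_cst|exact: cvgM n0 (cvg_cst _)].
  have B2 := cvgM dist0 (cvgM nd nd).
  by have := cvgD B1 (B2 _ _); rewrite !mul0r mulr0 addr0; apply.
apply/cvgrPdist_le => e e0.
have Be : \forall s \near within `[0, T] t^', B s <= e.
  have /cvgr0_norm_le/(_ _ e0) := B0.
  by apply: filterS => s; exact: le_trans (ler_norm _).
near=> s.
have sT : s \in `[0, T] by near: s; exact: withinT.
have st : s != t by near: s; apply: cvg_within; exact: withinT.
have st0 : s - t != 0 by rewrite subr_eq0.
apply: (@le_trans _ _ (B s)); last by near: s.
have uE : u s = (fun x => 1 * u t x + (s - t) * (q s \+ dut) x).
  by apply/funext => x; rewrite /q /=; field.
have qd2 : L2 (q s \+ dut).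
  have := L2_lin 1 1 (q2 _ sT) dut2; congr (Defs.L2 _ _).
  by apply/funext => x; rewrite !mul1r.
have qdE : inner (u t) (q s \+ dut) = inner (q s) (u t) + inner dut (u t).
  rewrite -[inner (q s) _]mul1r -[inner dut _]mul1r innerC.
  rewrite -inner_linl//; [|exact: q2|exact: u2].
  by apply: eq_Rintegral => x _; rewrite !mul1r.
rewrite uE inner_sqr_lin//; last exact: u2.
rewrite qdE.
set Q := inner (q s) (u t); set D := inner dut (u t).
set W := inner (q s \+ dut) _; set U := inner (u t) (u t).
have -> : 2 * D - (1 ^+ 2 * U + 2 * 1 * (s - t) * (Q + D) +
      (s - t) ^+ 2 * W - U) / (s - t)
    = - (2 * Q + (s - t) * W) by field.
rewrite normrN (le_trans (ler_normD _ _))// !normrM.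
rewrite (ger0_norm (inner_ge0 _ _)) ger0_norm//.
rewrite /B lerD// ler_wpM2l// nE//.
  exact: inner_cauchy_schwarz (q2 _ sT) (u2 _ tT).
exact: inner_sqr_triangle (q2 _ sT) dut2.
Unshelve. all: by end_near. Qed.

Lemma inner_sqr_cvg (I : Type) (F : set_system I) {FF : Filter F}
    (u : I -> 'rV[R]_d -> R) w :
  (\forall i \near F, L2 (u i)) -> L2 w ->
  L2norm Omega (u i \- w) @[i --> F] --> 0%E ->
  inner (u i) (u i) @[i --> F] --> inner w w.
Proof.
move=> u2 w2 ucvg; pose n i := fine (L2norm Omega (u i \- w)).
have n0 : n i @[i --> F] --> (0 : R) by exact: fine_cvg ucvg.
have B0 : 2 * (sqn w * n i) + n i * n i @[i --> F] --> (0 : R).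
  have B1 : 2 * (sqn w * n i) @[i --> F] --> 2 * (sqn w * 0).
    by apply: cvgM; [exact: cvg_cst|exact: cvgM (cvg_cst _) n0].
  by have := cvgD B1 (cvgM n0 n0); rewrite !mulr0 addr0; apply.
apply/cvgrPdist_le => e e0.
have Be : \forall i \near F, 2 * (sqn w * n i) + n i * n i <= e.
  have /cvgr0_norm_le/(_ _ e0) := B0.
  by apply: filterS => i; exact: le_trans (ler_norm _).
near=> i.
apply: (@le_trans _ _ (2 * (sqn w * n i) + n i * n i)); last by near: i.
have ui2 : L2 (u i) by near: i.
have ei2 := L2_sub ui2 w2.
have uE : u i = (fun x => 1 * w x + 1 * (u i \- w) x).
  by apply/funext => x /=; rewrite !mul1r addrC subrK.
have nE : n i = sqn (u i \- w) by rewrite /n L2normE.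
rewrite {1 2}uE inner_sqr_lin//.
have := inner_cauchy_schwarz w2 ei2; rewrite -nE => cs.
have nn : n i * n i = inner (u i \- w) (u i \- w).
  by rewrite nE -expr2 sqr_sqrtr ?inner_ge0.
rewrite nn; move: cs (inner_ge0 Omega (u i \- w)).
move: (inner w _) (inner w w) (inner (u i \- w) _) => a b c.
rewrite !ler_norml => /andP[ca cb] c0; apply/andP; split; lra.
Unshelve. all: by end_near. Qed.

Lemma L2_sum (I : Type) (r : seq I) (c : I -> R) (g : I -> 'rV[R]_d -> R) :
  (forall i, L2 (g i)) -> L2 (fun x => \sum_(i <- r) c i * g i x).
Proof.
move=> g2; elim: r => [|i r IH].
  rewrite (_ : (fun _ => _) = (fun=> 0)); last first.
    by apply/funext => x; rewrite big_nil.
  rewrite /Defs.L2 (_ : _ \_ _ = 0); first exact: (Lfun_addr_closed _ (lee1n 2)).1.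
  by apply/funext => x; rewrite patchE; case: ifPn.
have := L2_lin (c i) 1 (g2 i) IH; congr (Defs.L2 _ _).
by apply/funext => x; rewrite big_cons mul1r.
Qed.

Lemma inner_suml (I : Type) (r : seq I) (c : I -> R) (g : I -> 'rV[R]_d -> R) w :
  (forall i, L2 (g i)) -> L2 w ->
  inner (fun x => \sum_(i <- r) c i * g i x) w =
  \sum_(i <- r) c i * inner (g i) w.
Proof.
move=> g2 w2; elim: r => [|i r IH].
  rewrite big_nil /Defs.inner; under eq_Rintegral do rewrite big_nil mul0r.
  by rewrite /Rintegral integral0.
rewrite big_cons -IH -[X in _ + X]mul1r -inner_linl//; last exact: L2_sum.
by congr (Defs.inner _ _ _); apply/funext => x; rewrite big_cons mul1r.
Qed.

(** Expanding the square turns |w(t)|^2 into a finite combination of products of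
    indicator functions. *)
Lemma measurable_time_simple_inner w : time_simple Omega w ->
  measurable_fun [set: measurableTypeR R] (fun t => inner (w t) (w t)).
Proof.
move=> [m [A [g [Ag wE]]]].
have g2 i : L2 (g i) by have [] := Ag i.
have {wE} -> : (fun t => inner (w t) (w t)) = fun t =>
    \sum_(i < m) \1_(A i) t * \sum_(j < m) \1_(A j) t * inner (g j) (g i).
  apply/funext => t; have -> : w t = fun x => \sum_(i < m) \1_(A i) t * g i x.
    by apply/funext.
  rewrite inner_suml//; last exact: L2_sum.
  by apply: eq_bigr => i _; rewrite innerC inner_suml.
have mA i : measurable_fun [set: measurableTypeR R] (\1_(A i) : R -> R).
  by apply: measurable_indic; have [] := Ag i.
apply: measurable_sum => i; apply: measurable_funM => //.
by apply: measurable_sum => j; apply: measurable_funM.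
Qed.

Lemma time_Lp_norm_sqr (X : Type) (nrm : X -> \bar R) (T : R) (w : R -> X) :
  (forall s, 0 <= nrm (w s))%E ->
  (time_Lp_norm T nrm 2 w ^+ 2 =
   \int[lebesgue_measure]_(s in `]0%R, T]%classic) nrm (w s) ^+ 2)%E.
Proof.
move=> nrm0; rewrite /time_Lp_norm sqr_poweRV2.
  by apply: eq_integral => s _; rewrite poweR2.
by apply: integral_ge0 => s _; exact: poweR_ge0.
Qed.

(** On ]0, T] minus a null set N, |f(t)|^2 is a pointwise limit of measurable
    functions; phi extends it by 0, so that it stays below |f(t)|^2 on N too and
    its integral is at most the lower integral of |f(t)|^2. *)
Lemma L2_time_L2_measurable_version (T : R) f : L2_time_L2 Omega T f ->
  exists phi : R -> R, [/\ forall t, 0 <= phi t,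
    lebesgue_measure.-integrable `]0%R, T] (EFin \o phi),
    {ae lebesgue_measure, forall t, 0 < t <= T -> inner (f t) (f t) = phi t} &
    (\int[lebesgue_measure]_(t in `]0%R, T]) (phi t)%:E <=
      time_Lp_norm T (L2norm Omega) 2 f ^+ 2)%E].
Proof.
move=> [f2 [s [ssimple [N [mN N0 NP]]]] foo].
pose B : set (measurableTypeR R) := `]0, T]%classic `\` N.
have mB : measurable B by exact: measurableD.
have mf : measurable_fun B (fun t => inner (f t) (f t)).
  apply: (@measurable_fun_cvg _ _ _ _ (fun n t => inner (s n t) (s n t))).
    move=> n; apply: measurable_funTS.
    exact: measurable_time_simple_inner (ssimple n).
  move=> t [tT Nt]; apply: inner_sqr_cvg; [|exact: f2|].
    apply: nearW => n; have [m [A [g [Ag wE]]]] := ssimple n.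
    rewrite (_ : s n t = fun x => \sum_(i < m) \1_(A i) t * g i x).
      2: exact/funext.
    by apply: L2_sum => i; have [] := Ag i.
  by apply: contrapT => h; apply/Nt/NP => /(_ tT).
pose phi := (fun t => inner (f t) (f t)) \_ B.
have phi0 t : 0 <= phi t.
  by rewrite /phi patchE; case: ifPn => // _; exact: inner_ge0.
have phi_le : (\int[lebesgue_measure]_(t in `]0%R, T]) (phi t)%:E <=
      time_Lp_norm T (L2norm Omega) 2 f ^+ 2)%E.
  rewrite time_Lp_norm_sqr; last by move=> t; exact: Lnorm_ge0.
  apply: le_lower_integral => t tT; rewrite lee_fin phi0 L2norm_sqr; last exact: f2.
  rewrite andTb lee_fin /phi patchE.
  by case: ifPn => // _; exact: inner_ge0.
exists phi; split => //.
- apply/integrableP; split.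
    apply/measurable_EFinP/measurable_funTS.
    exact: (measurable_restrictT _ mB).1.
  rewrite (eq_integral (fun t => (phi t)%:E)); last first.
    by move=> t _ /=; rewrite ger0_norm.
  apply: le_lt_trans phi_le _; move: foo.
  have : (0 <= time_Lp_norm T (L2norm Omega) 2 f)%E by exact: poweR_ge0.
  case: time_Lp_norm => // r _ _.
  by rewrite -EFin_expe ltry.
- exists N; split => // t /= ht; apply: contrapT => Nt; apply: ht => tT.
  by rewrite /phi patchE mem_set//; split => //; rewrite /= in_itv.
Qed.

End L2_time.

(** * Linear differential inequalities *)

(** Scaling a simple function below f by c gives one below c f. *)
Lemma le_lower_integralZl d (T : measurableType d) (R : realType)
    (mu : {measure set T -> \bar R}) (D : set T) (f : T -> R) (c : R) :
  0 < c -> (forall x, D x -> 0 <= f x) ->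
  (c%:E * \int[mu]_(x in D) (f x)%:E <= \int[mu]_(x in D) (c * f x)%:E)%E.
Proof.
move=> c0 f0; rewrite muleC -lee_pdivlMr//.
apply: lower_integral_le => [x Dx|h hf h0]; first by rewrite lee_fin f0.
rewrite lee_pdivlMr// muleC -ge0_integralZl//.
- rewrite [leRHS]integral_mkcond; apply: le_lower_integral => x _.
  rewrite patchE -EFinM; case: ifPn => [/set_mem Dx|/negP nDx].
    rewrite !lee_fin ler_pM2l// mulr_ge0 ?(ltW c0)//=.
    by have := hf _ Dx; rewrite lee_fin.
  by rewrite h0 ?mulr0 ?lexx// => /mem_set.
- by apply/measurable_EFinP.
- by move=> x _; rewrite lee_fin.
- by rewrite ltW.
Qed.

Lemma within_quotient_left (R : realType) (y : R -> R) (T t l : R) :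
  0 < t <= T ->
  (y s - y t) / (s - t) @[s --> within `[0, T] t^'] --> l ->
  y s @[s --> t^'-] --> y t.
Proof.
move=> /andP[t0 tT] yl.
have yleft : (y s - y t) / (s - t) @[s --> t^'-] --> l.
  move=> U /yl; rewrite /nbhs/= => -[e /= e0 He]; near=> s.
  apply: He; [|by near: s; exact: nbhs_left_neq|].
    near: s; apply: cvg_within; exact: nbhsx_ballx.
  rewrite /= in_itv/=; apply/andP; split.
    by near: s; exact: nbhs_left_ge.
  by rewrite (le_trans _ tT)//; near: s; exact: nbhs_left_le.
have dist : s - t @[s --> t^'-] --> (0 : R).
  rewrite -[X in _ --> X](subrr t).
  by apply: cvgB; [exact: cvg_within|exact: cvg_cst].
have yd : (y s - y t) / (s - t) * (s - t) @[s --> t^'-] --> l * 0.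
  exact: cvgM yleft dist.
have {yd} : (y s - y t) / (s - t) * (s - t) + y t @[s --> t^'-] --> l * 0 + y t.
  exact: cvgD yd (cvg_cst _).
rewrite mulr0 add0r; apply: cvg_trans.
apply: near_eq_cvg; near=> s => /=.
have st : s - t != 0 by rewrite subr_eq0; near: s; exact: nbhs_left_neq.
by rewrite /= divfK// subrK.
Unshelve. all: by end_near. Qed.

Lemma within_quotient_is_derive (R : realType) (y : R -> R) (T t l : R) :
  0 < t < T ->
  (y s - y t) / (s - t) @[s --> within `[0, T] t^'] --> l ->
  is_derive t 1 y l.
Proof.
move=> tT yl; apply/is_derive1_caratheodory.
exists (fun s => if s == t then l else (y s - y t) / (s - t)); split.
- move=> s; case: eqVneq => [->|st]; first by rewrite !subrr mulr0.
  by rewrite divfK// subr_eq0.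
- apply/continuous_withinNx; rewrite eqxx => U /yl.
  rewrite /nbhs/= => -[e /= e0 He]; near=> s.
  have st : s != t by near: s; exact: nbhs_dnbhs_neq.
  rewrite /= (negbTE st); apply: He => //.
    near: s; apply: cvg_within; exact: nbhsx_ballx.
  near: s; apply: cvg_within.
  have tin : t \in `]0, T[ by rewrite in_itv.
  have := near_in_itvoo tin; apply: filterS => s; rewrite /= !in_itv/=.
  by move=> /andP[/ltW-> /ltW->].
- by rewrite eqxx.
Unshelve. all: by end_near. Qed.

(** The function z t = exp(k (T - t)) y t satisfies
    z' <= exp(k (T - t)) (phi - D) <= exp(k T) phi - D.  The integrating factor
    is normalised to be at least 1 on [0, T], so that D keeps the coefficient 1:
    pulling a constant out of its lower integral is avoided. *)
Lemma gronwall_dissipation (R : realType) (T k : R) (y dy phi D : R -> R) :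
  0 < T -> 0 <= k -> (forall t, 0 <= y t) ->
  y s @[s --> 0^'+] --> y 0 ->
  (forall t, 0 < t <= T ->
    (y s - y t) / (s - t) @[s --> within `[0, T] t^'] --> dy t) ->
  (forall t, 0 <= phi t) ->
  lebesgue_measure.-integrable `]0, T] (EFin \o phi) ->
  (forall t, 0 < t <= T -> 0 <= D t) ->
  {ae lebesgue_measure, forall t, 0 < t <= T -> dy t + D t <= k * y t + phi t} ->
  forall b, 0 <= b <= T ->
  ((y b)%:E + \int[lebesgue_measure]_(t in `]0%R, b]) (D t)%:E <=
   (expR (k * T))%:E *
     ((y 0)%:E + \int[lebesgue_measure]_(t in `]0%R, T]) (phi t)%:E))%E.
Proof.
move=> T0 k0 y0 ycont dyE phi0 iphi D0 dyphi b /andP[b0 bT].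
have mT : measurable (`]0, T]%classic : set (measurableTypeR R)) by [].
pose I := \int[lebesgue_measure]_(t in `]0, T]) phi t.
have IE : (\int[lebesgue_measure]_(t in `]0%R, T]) (phi t)%:E)%E = I%:E.
  by rewrite /I /Rintegral fineK// integrable_fin_num.
have I0 : 0 <= I by apply: Rintegral_ge0.
have E1 t : t <= T -> 1 <= expR (k * (T - t)).
  by move=> tT; rewrite -expR0 ler_expR mulr_ge0// subr_ge0.
have ET : 1 <= expR (k * T) by have := E1 0 (ltW T0); rewrite subr0.
move: b0; rewrite le_eqVlt => /predU1P[<-|b0].
  rewrite set_itv_ge -?leNgt ?bnd_simp// integral_set0 adde0 IE.
  rewrite -EFinD -EFinM lee_fin.
  by rewrite (le_trans _ (ler_peMl _ ET)) ?addr_ge0// lerDl.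
pose E t := expR (k * (T - t)).
have dE (t : R) : is_derive t 1 E (- k * E t).
  have dl : is_derive t 1 (fun t => k * (T - t)) (- k).
    apply/is_derive1_caratheodory; exists (fun=> - k).
    by split => // [s|]; [ring|exact: cvg_cst].
  have := is_derive1_comp (f := expR) (g := fun t => k * (T - t))
    (is_derive_expR (k * (T - t))) dl.
  by rewrite /E mulrC.
have cE : continuous E.
  move=> t; apply/differentiable_continuous/derivable1_diffP.
  by have [] := dE t.
pose z t := E t * y t.
pose c := expR (k * T).
have mb : measurable (`]0, b]%classic : set (measurableTypeR R)) by [].
have sub_b : `]0, b]%classic `<=` `]0, T]%classic.
  by apply: subset_itvl; rewrite bnd_simp.
have iS : lebesgue_measure.-integrable `]0%R, b] (EFin \o (fun t => c * phi t)).
  exact: (integrableZl mb c (integrableS mT mb sub_b iphi)).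
have phib : (\int[lebesgue_measure]_(t in `]0%R, b]) (c * phi t)%:E <=
     (c * I)%:E)%E.
  rewrite EFinM -IE -ge0_integralZl//; last 3 first.
  - by have /integrableP[] := iphi.
  - by move=> t _; rewrite lee_fin.
  - by rewrite lee_fin expR_ge0.
  apply: ge0_subset_integral => //.
  - exact: (measurable_int _ (integrableZl mT c iphi)).
  - by move=> t _; rewrite lee_fin mulr_ge0// expR_ge0.
have := @growth_le_lower_integral R z
  (fun t => E t * dy t + y t * (- k * E t)) (fun t => c * phi t) D 0 b b0.
have zb : y b <= z b by rewrite /z ler_peMl// E1.
have -> : z 0 = c * y 0 by rewrite /z /E subr0.
move=> /(_ _ _ _ _ iS) H; rewrite IE -EFinD -EFinM mulrDr.
have {}H : ((z b - c * y 0)%:E +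
    \int[lebesgue_measure]_(t in `]0%R, b]) (D t)%:E <= (c * I)%:E)%E.
  apply: le_trans phib; apply: H.
  - rewrite (_ : c * y 0 = E 0 * y 0); last by rewrite /E subr0.
    by apply: cvgM ycont; apply: cvg_at_right_filter; exact: cE.
  - move=> t /andP[t0 tb]; apply: cvgM.
      by apply: cvg_at_left_filter; exact: cE.
    by apply: (within_quotient_left (T := T)) (dyE _ _); rewrite t0 (le_trans tb).
  - move=> t /andP[t0 tb]; apply: is_deriveM.
    have tT : t < T by exact: lt_le_trans tb bT.
    by apply: (within_quotient_is_derive (T := T)) (dyE _ _); rewrite t0 ?ltW.
  - by move=> t; rewrite mulr_ge0// expR_ge0.
  - by move=> t /andP[t0 tb]; rewrite D0// t0 (le_trans tb).
  - apply: filterS dyphi; first exact: (ae_filter_ringOfSetsType lebesgue_measure).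
    move=> t dyt /andP[t0 tb].
    have tT : t <= T by rewrite ltW// (lt_le_trans tb).
    have Dt : 0 <= D t by rewrite D0// t0.
    have {}dyt : dy t + D t <= k * y t + phi t by apply: dyt; rewrite t0.
    have Et := E1 _ tT; rewrite -/(E t) in Et.
    have Ec : E t <= c by rewrite ler_expR ler_wpM2l// lerBlDr lerDl ltW.
    have := ler_wpM2l (expR_ge0 (k * (T - t))) dyt; rewrite -/(E t).
    have := ler_wpM2l Dt Et; have := ler_wpM2l (phi0 t) Ec.
    by move: (E t) => e; lra.
have : (0 <= \int[lebesgue_measure]_(t in `]0%R, b]) (D t)%:E)%E.
  apply: integral_ge0 => t; rewrite /= in_itv/= => /andP[t0 tb].
  by rewrite lee_fin D0// t0 (le_trans tb).
move: H; case: (integral _ _ _) => // r.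
by rewrite -!EFinD !lee_fin -/c; lra.
Qed.

(** * The energy estimate *)

Section energy.
Context (R : realType) (d : nat) (Omega : set 'rV[R]_d).
Local Notation mu := (lebesgue_rV R d).
Local Notation inner := (inner Omega).

(** The negative part of v^4 - v^2 is at most v^2, which is integrable.  The
    positive part may have infinite integral: the real-valued integral is then
    0 by convention, and the bound persists. *)
Lemma inner_gfun_ge (v : 'rV[R]_d -> R) : L2 Omega v ->
  - inner v v <= inner (@gfun R \o v) v.
Proof.
move=> v2; pose F x := (gfun (v x) * v x)%:E.
have -> : inner (@gfun R \o v) v = fine (\int[mu]_(x in Omega) F x)%E by [].
rewrite integralE.
have Fneg : (\int[mu]_(x in Omega) (F^\- x) <= (inner v v)%:E)%E.
  rewrite -L2norm_sqr// L2norm_sqr_integral; apply: le_lower_integral => x _.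
  rewrite funeneg_ge0/= funenegE ge_max -EFinN !lee_fin sqr_ge0 andbT /gfun.
  have : 0 <= v x ^+ 4 by rewrite exprn_even_ge0.
  by rewrite expr2 mulrBl -exprSr; lra.
have := inner_ge0 Omega v.
have : (0 <= \int[mu]_(x in Omega) (F^\- x))%E by apply: integral_ge0.
have : (0 <= \int[mu]_(x in Omega) (F^\+ x))%E by apply: integral_ge0.
move: Fneg; case: (integral _ _ (F^\-)%E) => // n.
case: (integral _ _ (F^\+)%E) => [p| |]//=; rewrite !lee_fin; lra.
Qed.

Lemma L2_wdiv (tau : 'rV[R]_d -> 'rV[R]_d) :
  Hdiv Omega tau -> L2 Omega (wdiv Omega tau).
Proof. by move=> [_ /getPex[]]. Qed.

Lemma Mspace_Hdiv bc (tau : 'rV[R]_d -> 'rV[R]_d) :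
  Mspace Omega bc tau -> Hdiv Omega tau.
Proof. by case: bc => // -[]. Qed.

Lemma Uspace_L2 bc (v : 'rV[R]_d -> R) : Uspace Omega bc v -> L2 Omega v.
Proof. by case: bc => // -[]. Qed.

(** Testing with (u t, sigma t); the term (f, u) is split by expanding
    |f - u|^2 >= 0. *)
Lemma weak_solution_energy (T gamma : R) bc f u0 u sigma phi :
  (forall t, t \in `]0, T] -> L2 Omega (f t)) ->
  weak_solution Omega T bc gamma f u0 u sigma phi ->
  forall t, t \in `]0, T] -> exists dut, is_time_deriv Omega T u t dut /\
    2 * inner dut (u t) + 2 * (gamma *
      inner (wdiv Omega (sigma t)) (wdiv Omega (sigma t)) +
      innerv Omega (sigma t) (sigma t)) <=
    3 * inner (u t) (u t) + inner (f t) (f t).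
Proof.
move=> f2 [_ _ sol] t tT; have [Uu Ms Mp [dut dutP weak] constr] := sol t tT.
have ut2 := Uspace_L2 Uu; exists dut; split => //.
have := weak _ _ Uu Ms; rewrite (constr _ Mp) addr0 /aform /cform /=.
have := inner_gfun_ge ut2.
have := inner_ge0 Omega (fun x => 1 * f t x + (-1) * u t x).
by rewrite inner_sqr_lin//; [lra|exact: f2].
Qed.

End energy.

Unset Implicit Arguments.

Theorem lemma3 (R : realType) (d : nat) (Omega : set 'rV[R]_d)
    (bc : boundary_case) (T gamma : R) :
  d = 2%N \/ d = 3%N ->
  convex_polyhedral_domain Omega ->
  0 < T -> 0 < gamma ->
  exists2 C : R, 0 < C &
    forall (f : R -> 'rV[R]_d -> R) (u0 : 'rV[R]_d -> R)
      (u : R -> 'rV[R]_d -> R) (sigma phi : R -> 'rV[R]_d -> 'rV[R]_d),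
    L2_time_L2 Omega T f ->
    L2 Omega u0 ->
    weak_solution Omega T bc gamma f u0 u sigma phi ->
    ((2^-1)%:E * time_Linfty_norm T (L2norm Omega) u ^+ 2
     + gamma%:E *
       time_Lp_norm T (L2norm Omega) 2 (fun t => wdiv Omega (sigma t)) ^+ 2
     + time_Lp_norm T (L2vnorm Omega) 2 sigma ^+ 2
     <= C%:E * (L2norm Omega u0 ^+ 2
                + time_Lp_norm T (L2norm Omega) 2 f ^+ 2))%E.
Proof.
(* each of the three terms is bounded by exp(3 T) (|u_0|^2 + int |f|^2) *)
move=> _ _ T0 gamma0; exists (3 * expR (3 * T)).
  by rewrite mulr_gt0 ?expR_gt0.
move=> f u0 u sigma phi ftime u02 solution.
have f2 t : t \in `]0, T] -> L2 Omega (f t) by have [+ _ _] := ftime; apply.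
have energy := weak_solution_energy f2 solution.
have [[uz2 uz] u_cont sol] := solution.
have ioc t : 0 < t <= T -> t \in `]0, T] by rewrite in_itv.
have u2 t : t \in `[0, T] -> L2 Omega (u t).
  rewrite in_itv/= => /andP[]; rewrite le_eqVlt => /predU1P[<-//|t0] tT.
  by have /ioc/sol[/Uspace_L2] : 0 < t <= T by rewrite t0.
pose div2 t := inner Omega (wdiv Omega (sigma t)) (wdiv Omega (sigma t)).
pose sigma2 t := innerv Omega (sigma t) (sigma t).
have sigmaH t : 0 < t <= T -> Hdiv Omega (sigma t).
  by move=> /ioc/sol[_ /Mspace_Hdiv].
have div2_ge0 t : 0 <= div2 t by exact: inner_ge0.
have sigma2_ge0 t : 0 <= sigma2 t.
  by apply: Rintegral_ge0 => x _; apply: sumr_ge0 => i _; rewrite -expr2 sqr_ge0.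
have [psi [psi0 ipsi psiE psi_le]] := L2_time_L2_measurable_version ftime.
pose y t := inner Omega (u t) (u t).
have /choice[dy dyP] : forall t, exists l, 0 < t <= T ->
    ((y s - y t) / (s - t) @[s --> within `[0, T] t^'] --> l) /\
    l + 2 * (gamma * div2 t + sigma2 t) <= 3 * y t + inner Omega (f t) (f t).
  move=> t; have [tT|] := boolP (0 < t <= T); last by exists 0.
  have [dut [dutP ener]] := energy t (ioc t tT).
  exists (2 * inner Omega dut (u t)) => _; split => //.
  apply: is_time_deriv_inner dutP => //.
  by rewrite in_itv/=; move/andP : tT => [/ltW-> ->].
have yE0 : y 0 = inner Omega u0 u0 by exact: ae_eq_inner.
have y_cont : y s @[s --> 0^'+] --> y 0.
  apply: inner_sqr_cvg => //; near=> s; apply: u2; rewrite in_itv/=.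
  apply/andP; split; first by near: s; exact: nbhs_right_ge.
  by near: s; exact: nbhs_right_le.
have bound := @gronwall_dissipation R T 3 y dy psi
  (fun t => 2 * (gamma * div2 t + sigma2 t)) T0 _ _ y_cont _ psi0 ipsi _ _.
pose K : \bar R := ((expR (3 * T))%:E * ((y 0)%:E +
  \int[lebesgue_measure]_(t in `]0%R, T]) (psi t)%:E))%E.
have {}bound b : 0 <= b <= T ->
    ((y b)%:E + \int[lebesgue_measure]_(t in `]0%R, b])
      (2 * (gamma * div2 t + sigma2 t))%:E <= K)%E.
  apply: bound.
  - by [].
  - by move=> t; exact: inner_ge0.
  - by move=> t /dyP[].
  - by move=> t _; rewrite mulr_ge0// addr_ge0// mulr_ge0// ltW.
  - apply: filterS psiE; first exact: (ae_filter_ringOfSetsType lebesgue_measure).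
    by move=> t psit tT; rewrite -psit//; have [] := dyP t tT.
have K_fin : K \is a fin_num.
  by rewrite fin_numM// fin_numD//; apply: integrable_fin_num.
have dissip_ge0 b : (0 <= \int[lebesgue_measure]_(t in `]0%R, b])
    (2 * (gamma * div2 t + sigma2 t))%:E)%E.
  apply: integral_ge0 => t _.
  by rewrite lee_fin mulr_ge0// addr_ge0// mulr_ge0// ltW.
have y_le b : 0 <= b <= T -> ((y b)%:E <= K)%E.
  by move=> bT; apply: le_trans (bound b bT); rewrite leeDl.
have dissip_le : (\int[lebesgue_measure]_(t in `]0%R, T])
    (2 * (gamma * div2 t + sigma2 t))%:E <= K)%E.
  apply: le_trans (bound T _); last by rewrite lexx ltW.
  by rewrite leeDr// lee_fin; exact: inner_ge0.
have sup_le : (time_Linfty_norm T (L2norm Omega) u ^+ 2 <= K)%E.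
  have y0 t : 0 <= y t by exact: inner_ge0.
  have y_leR b : 0 <= b <= T -> y b <= fine K.
    by move=> /y_le; rewrite -(fineK K_fin) lee_fin.
  have yK t : t \in `[0, T] -> (L2norm Omega (u t) <= (Num.sqrt (fine K))%:E)%E.
    move=> tT; rewrite L2normE ?lee_fin ?ler_wsqrtr//; last exact: u2.
    by apply: y_leR; rewrite in_itv/= in tT.
  have K0 : 0 <= fine K by apply: le_trans (y0 0) (y_leR 0 _); rewrite lexx ltW.
  have : (time_Linfty_norm T (L2norm Omega) u <= (Num.sqrt (fine K))%:E)%E.
    by apply: ge_ereal_sup => _ [t tT <-]; exact: yK.
  have : (0 <= time_Linfty_norm T (L2norm Omega) u)%E.
    apply: (@le_trans _ _ (L2norm Omega (u 0))); first exact: Lnorm_ge0.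
    apply: ereal_sup_ubound; exists 0 => //.
    by rewrite /= in_itv/= lexx ltW.
  case: time_Linfty_norm => // r; rewrite !lee_fin -EFin_expe => r0 rK.
  rewrite -(fineK K_fin) lee_fin -(sqr_sqrtr K0).
  by rewrite lerXn2r// nnegrE// sqrtr_ge0.
have div_le : (gamma%:E * time_Lp_norm T (L2norm Omega) 2
    (fun t => wdiv Omega (sigma t)) ^+ 2 <= K)%E.
  rewrite time_Lp_norm_sqr; last by move=> t; exact: Lnorm_ge0.
  rewrite (eq_integral (fun t : measurableTypeR R => (div2 t)%:E)); last first.
    move=> t /[!inE] tT; rewrite L2norm_sqr//.
    by apply/L2_wdiv/sigmaH; move: tT; rewrite /= in_itv.
  apply: le_trans (le_lower_integralZl _ gamma0 _) _ => //.
  apply: le_trans dissip_le; apply: le_lower_integral => t _.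
  rewrite !lee_fin mulr_ge0 ?(ltW gamma0)//=.
  by have := mulr_ge0 (ltW gamma0) (div2_ge0 t); have := sigma2_ge0 t; lra.
have sigma_le : (time_Lp_norm T (L2vnorm Omega) 2 sigma ^+ 2 <= K)%E.
  rewrite time_Lp_norm_sqr; last by move=> t; exact: Lnorm_ge0.
  rewrite (eq_integral (fun t : measurableTypeR R => (sigma2 t)%:E)); last first.
    move=> t /[!inE] tT; rewrite L2vnorm_sqr//.
    by have [] := sigmaH t _; first by move: tT; rewrite /= in_itv.
  apply: le_trans dissip_le; apply: le_lower_integral => t _.
  rewrite !lee_fin sigma2_ge0/=.
  by have := mulr_ge0 (ltW gamma0) (div2_ge0 t); have := sigma2_ge0 t; lra.
have K_le : (K <= (expR (3 * T))%:E * (L2norm Omega u0 ^+ 2 +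
    time_Lp_norm T (L2norm Omega) 2 f ^+ 2))%E.
  rewrite lee_pmul2l// ?lte_fin ?expR_gt0//.
  by rewrite yE0 -L2norm_sqr// leeD.
apply: (@le_trans _ _ (3%:E * K)%E); last first.
  by rewrite EFinM -muleA lee_pmul2l.
have K0 : (0 <= K)%E by apply: le_trans dissip_le; exact: dissip_ge0.
rewrite -(fineK K_fin) in K0 sup_le div_le sigma_le *.
have half : ((2^-1)%:E * time_Linfty_norm T (L2norm Omega) u ^+ 2 <= (fine K)%:E)%E.
  apply: le_trans (lee_wpmul2l _ sup_le) _; first by rewrite lee_fin.
  by rewrite -EFinM lee_fin; move: K0; rewrite lee_fin; lra.
apply: le_trans (leeD (leeD half div_le) sigma_le) _.
by rewrite -!EFinD -EFinM lee_fin; lra.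
Unshelve. all: by end_near. Qed.
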